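(* Let $d\ge1$, $k\ge2$, and let $(f,a),(g,b)\in\wr_p^k\mathcal{IS}_d$ (so $f,g$ take values in $\wr_p^{k-1}\mathcal{IS}_d$, and Green's relations on these values are taken in $\wr_p^{k-1}\mathcal{IS}_d$). Then: (1) $(f,a)\,\mathcal L\,(g,b)$ if and only if $\mathrm{ran}(a)=\mathrm{ran}(b)$ and $g^{b^{-1}}(z)\,\mathcal L\, f^{a^{-1}}(z)$ for all $z\in\mathrm{ran}(a)$, where $a^{-1}$ is the inverse of $a$ in $\mathcal{IS}_d$; (2) $(f,a)\,\mathcal R\,(g,b)$ if and only if $\mathrm{dom}(a)=\mathrm{dom}(b)$ and $f(z)\,\mathcal R\, g(z)$ for all $z\in\mathrm{dom}(a)$; (3) $(f,a)\,\mathcal H\,(g,b)$ if and only if $\mathrm{ran}(a)=\mathrm{ran}(b)$, $\mathrm{dom}(a)=\mathrm{dom}(b)$, $g^{b^{-1}}(z)\,\mathcal L\, f^{a^{-1}}(z)$ for all $z\in\mathrm{ran}(a)$, and $f(z)\,\mathcal R\, g(z)$ for all $z\in\mathrm{dom}(a)$; (4) $(f,a)\,\mathcal D\,(g,b)$ if and only if there exists a bijection $x:\mathrm{dom}(b)\to\mathrm{dom}(a)$ such that $f(zx)\,\mathcal D\, g(z)$ for all $z\in\mathrm{dom}(b)$; (5) $\mathcal D=\mathcal J$ on $\wr_p^k\mathcal{IS}_d$.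
   Context: $\mathcal{IS}_d$ is the semigroup of all injective partial maps of $N_d=\{1,\dots,d\}$ (including the empty map), written on the right, $x(ab)=(xa)b$, with domain $\mathrm{dom}$ and range $\mathrm{ran}$. For a semigroup $S$, $F(N_d,S)$ is the set of functions $f$ from a subset $\mathrm{dom}(f)\subseteq N_d$ to $S$ with $\mathrm{dom}(fg)=\mathrm{dom}(f)\cap\mathrm{dom}(g)$, $(fg)(x)=f(x)g(x)$; for $a\in\mathcal{IS}_d$, $\mathrm{dom}(f^a)=\{x\in\mathrm{dom}(a):xa\in\mathrm{dom}(f)\}$, $f^a(x)=f(xa)$. $S\wr_p\mathcal{IS}_d=\{(f,a)\in F(N_d,S)\times\mathcal{IS}_d:\mathrm{dom}(f)=\mathrm{dom}(a)\}$ with $(f,a)(g,b)=(fg^a,ab)$; $\wr_p^1\mathcal{IS}_d=\mathcal{IS}_d$ and $\wr_p^k\mathcal{IS}_d=(\wr_p^{k-1}\mathcal{IS}_d)\wr_p\mathcal{IS}_d$ for $k\ge2$. $\mathcal L,\mathcal R,\mathcal H,\mathcal D,\mathcal J$ are Green's relations. *)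

(* Defs.v *)
From HB Require Import structures.
From mathcomp Require Import all_boot all_fingroup.

Set Implicit Arguments.
Unset Strict Implicit.
Unset Printing Implicit Defensive.

Local Open Scope group_scope.

(* Partial functions from N_d to S; N_d is rendered as 'I_d = {0, ..., d-1}
   and [None] means "undefined". *)
Notation pfun d S := {ffun 'I_d -> option S}.

Definition pdom (d : nat) (S : Type) (f : pfun d S) : {set 'I_d} :=
  [set x | isSome (f x)].

Definition pran (d : nat) (a : pfun d 'I_d) : {set 'I_d} :=
  [set y | [exists x, a x == Some y]].

(* f^a : x |-> f (x a).  Maps act on the right, so for f : pfun d 'I_d this is
   also the product a f. *)
Definition ppow (d : nat) (S : Type) (f : pfun d S) (a : pfun d 'I_d) :
  pfun d S := [ffun x => obind f (a x)].

Definition pmul (d : nat) (S : semigroupType) (f g : pfun d S) : pfun d S :=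
  [ffun x => obind (fun s => omap (fun t => s * t) (g x)) (f x)].

Definition pconv (d : nat) (a : pfun d 'I_d) : pfun d 'I_d :=
  [ffun y => [pick x | a x == Some y]].

Record IS (d : nat) := MkIS {
  IS_val :> pfun d 'I_d;
  _ : dinjectiveb IS_val (mem (pdom IS_val))
}.

HB.instance Definition _ (d : nat) := [isSub for @IS_val d].
HB.instance Definition _ (d : nat) := [Finite of IS d by <:].

Lemma IS_inj (d : nat) (a : IS d) (x y z : 'I_d) :
  a x = Some z -> a y = Some z -> x = y.
Proof.
case: a => a /= /dinjectiveP inj_a ax ay.
by apply: inj_a; rewrite ?inE ?ax ?ay.
Qed.

Lemma IS_intro (d : nat) (a : pfun d 'I_d) :
  (forall x y z, a x = Some z -> a y = Some z -> x = y) ->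
  dinjectiveb a (mem (pdom a)).
Proof.
move=> inj_a; apply/dinjectiveP => x y; rewrite !inE.
by case ax: (a x) => [z|] // _ _ /esym; apply: inj_a.
Qed.

Lemma ISmul_subproof (d : nat) (a b : IS d) :
  dinjectiveb (ppow b a) (mem (pdom (ppow b a))).
Proof.
apply: IS_intro => x y z; rewrite !ffunE.
case ax: (a x) => [u|] //=; case ay: (a y) => [v|] //= bu bv.
by apply: (IS_inj ax); rewrite ay (IS_inj bu bv).
Qed.

Definition ISmul (d : nat) (a b : IS d) : IS d := MkIS (ISmul_subproof a b).

Lemma ISmulA (d : nat) : associative (@ISmul d).
Proof.
move=> a b c; apply: val_inj; apply/ffunP => x /=; rewrite !ffunE.
by case: (a x) => //= y; rewrite !ffunE.
Qed.

HB.instance Definition _ (d : nat) := isSemigroup.Build (IS d) (@ISmulA d).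

Lemma pconvP (d : nat) (a : IS d) (x y : 'I_d) :
  pconv a y = Some x <-> a x = Some y.
Proof.
rewrite ffunE; case: pickP => [u /eqP au|none]; split=> //.
- by case=> <-.
- by move=> ax; rewrite (IS_inj au ax).
- by move=> ax; have := none x; rewrite ax eqxx.
Qed.

Lemma ISinv_subproof (d : nat) (a : IS d) :
  dinjectiveb (pconv a) (mem (pdom (pconv a))).
Proof.
by apply: IS_intro => x y z /pconvP az /pconvP; rewrite az => -[].
Qed.

Definition ISinv (d : nat) (a : IS d) : IS d := MkIS (ISinv_subproof a).

(* [ISinv a] is the unique semigroup inverse of [a]. *)
Lemma ISinv_inverse (d : nat) (a b : IS d) :
  a * b * a = a /\ b * a * b = b <-> b = ISinv a.
Proof.
have mulE (p q : IS d) x : (p * q) x = obind q (p x) by rewrite ffunE.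
split=> [[aba bab]|->].
  apply: val_inj; apply/ffunP => y /=.
  have conv (p q : IS d) x z : p * q * p = p -> p x = Some z -> q z = Some x.
    move=> pqp px; have := congr1 (fun c : IS d => c x) pqp.
    rewrite !mulE px /=; case: (q z) => [u|] //= pu.
    by rewrite (IS_inj pu px).
  case by_: (b y) => [x|].
    by apply/esym/pconvP; apply: conv bab by_.
  case ay: (pconv a y) => [x|] //.
  by move/pconvP: ay => /(conv _ _ _ _ aba); rewrite by_.
have invE x y : ISinv a y = Some x <-> a x = Some y by apply: pconvP.
split; apply: val_inj; apply/ffunP => x; rewrite [LHS]mulE mulE.
- by case ax: (a x) => [y|] //=; have /invE -> /= := ax.
- by case ax: (ISinv a x) => [y|] //=; have /invE -> /= := ax.
Qed.

(* The partial wreath product S wr_p IS_d. *)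
Record wreath (d : nat) (S : Type) := Wreath {
  wval : pfun d S * IS d;
  _ : pdom wval.1 == pdom wval.2
}.
Arguments Wreath {d S} wval _.

HB.instance Definition _ (d : nat) (S : Type) := [isSub for @wval d S].
HB.instance Definition _ (d : nat) (S : choiceType) :=
  [Choice of wreath d S by <:].

Lemma wmul_subproof (d : nat) (S : semigroupType) (u v : wreath d S) :
  pdom (pmul (wval u).1 (ppow (wval v).1 (wval u).2)) ==
  pdom ((wval u).2 * (wval v).2).
Proof.
case: u v => [[f a] /= /eqP dfa] [[g b] /= /eqP dgb].
apply/eqP/setP => x; rewrite !inE !ffunE.
have := congr1 (fun A : {set 'I_d} => x \in A) dfa; rewrite !inE.
case: (f x) (a x) => [s|] [y|] //= _.
have := congr1 (fun A : {set 'I_d} => y \in A) dgb; rewrite !inE => <-.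
by case: (g y).
Qed.

Definition wmul (d : nat) (S : semigroupType) (u v : wreath d S) :
  wreath d S :=
  Wreath (pmul (wval u).1 (ppow (wval v).1 (wval u).2),
          (wval u).2 * (wval v).2) (wmul_subproof u v).

Lemma wmulA (d : nat) (S : semigroupType) : associative (@wmul d S).
Proof.
move=> [[f a] dfa] [[g b] dgb] [[h c] dhc]; apply: val_inj => /=.
congr pair; last exact: mulgA.
apply/ffunP => x; rewrite !ffunE.
case: (f x) (a x) => [s|] [y|] //=; rewrite ?ffunE; case: (g y) => //= t.
by case: (b y) => //= z; case: (h z) => //= r; rewrite mulgA.
Qed.

HB.instance Definition _ (d : nat) (S : semigroupType) :=
  isSemigroup.Build (wreath d S) (@wmulA d S).

(* wrp d k is the k-fold iterated product for k >= 1; wrp d 0 is a dummy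
   value. *)
Fixpoint wrp (d k : nat) : semigroupType :=
  match k with
  | 0 => IS d
  | 1 => IS d
  | j.+1 => wreath d (wrp d j)
  end.

(* Products with an element of S^1, where [None] is the adjoined identity. *)
Definition mul1l (S : semigroupType) (s : option S) (x : S) : S :=
  if s is Some s' then s' * x else x.

Definition mul1r (S : semigroupType) (x : S) (t : option S) : S :=
  if t is Some t' then x * t' else x.

Definition left_ideal (S : semigroupType) (x y : S) : Prop :=
  exists s : option S, y = mul1l s x.

Definition right_ideal (S : semigroupType) (x y : S) : Prop :=
  exists t : option S, y = mul1r x t.

Definition two_sided_ideal (S : semigroupType) (x y : S) : Prop :=
  exists s t : option S, y = mul1r (mul1l s x) t.

Definition green_L (S : semigroupType) (x y : S) : Prop :=
  forall z, left_ideal x z <-> left_ideal y z.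

Definition green_R (S : semigroupType) (x y : S) : Prop :=
  forall z, right_ideal x z <-> right_ideal y z.

Definition green_J (S : semigroupType) (x y : S) : Prop :=
  forall z, two_sided_ideal x z <-> two_sided_ideal y z.

Definition green_H (S : semigroupType) (x y : S) : Prop :=
  green_L x y /\ green_R x y.

Definition green_D (S : semigroupType) (x y : S) : Prop :=
  exists z, green_L x z /\ green_R z y.

Lemma green_LE (S : semigroupType) (x y : S) :
  green_L x y <-> left_ideal x y /\ left_ideal y x.
Proof.
have tr (p q r : S) : left_ideal p q -> left_ideal q r -> left_ideal p r.
  move=> [[s|] ->] [[t|] ->] /=; [by exists (Some (t * s)); rewrite /= mulgA|..].
  - by exists (Some s).
  - by exists (Some t).
  - by exists None.
split=> [xy|[xy yx] z]; last by split; apply: tr.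
by split; apply/xy; exists None.
Qed.

Lemma green_RE (S : semigroupType) (x y : S) :
  green_R x y <-> right_ideal x y /\ right_ideal y x.
Proof.
have tr (p q r : S) : right_ideal p q -> right_ideal q r -> right_ideal p r.
  move=> [[s|] ->] [[t|] ->] /=; [by exists (Some (s * t)); rewrite /= mulgA|..].
  - by exists (Some s).
  - by exists (Some t).
  - by exists None.
split=> [xy|[xy yx] z]; last by split; apply: tr.
by split; apply/xy; exists None.
Qed.

Lemma mul1A (S : semigroupType) (s t : option S) (x : S) :
  mul1l s (mul1r x t) = mul1r (mul1l s x) t.
Proof. by case: s t => [s|] [t|] //=; rewrite mulgA. Qed.

Lemma green_LR_comm (S : semigroupType) (x y : S) :
  green_D x y <-> exists z, green_R x z /\ green_L z y.
Proof.
split=> -[z].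
- move=> [/green_LE[[s zE] [s' xE]] /green_RE[[t yE] [t' zE']]].
  exists (mul1r x t); split; [apply/green_RE|apply/green_LE]; split.
  + by exists t.
  + by exists t'; rewrite xE -!mul1A -yE -zE'.
  + by exists s; rewrite mul1A -zE.
  + by exists s'; rewrite yE mul1A -xE.
- move=> [/green_RE[[t zE] [t' xE]] /green_LE[[s yE] [s' zE']]].
  exists (mul1l s x); split; [apply/green_LE|apply/green_RE]; split.
  + by exists s.
  + by exists s'; rewrite xE !mul1A -yE -zE'.
  + by exists t; rewrite -mul1A -zE.
  + by exists t'; rewrite yE -mul1A -xE.
Qed.

(* [green_D] is the join of [green_L] and [green_R]. *)
Lemma green_D_join (S : semigroupType) (x y : S) :
  green_D x y <->
  forall r : S -> S -> Prop,
    (forall p, r p p) -> (forall p q, r p q -> r q p) ->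
    (forall p q t, r p q -> r q t -> r p t) ->
    (forall p q, green_L p q -> r p q) -> (forall p q, green_R p q -> r p q) ->
    r x y.
Proof.
split=> [[z [xz zy]] r _ _ tr rL rR|]; first exact: tr (rL _ _ xz) (rR _ _ zy).
have L1 (p : S) : green_L p p by [].
have R1 (p : S) : green_R p p by [].
have Ls (p q : S) : green_L p q -> green_L q p by move=> h z; apply: iff_sym.
have Rs (p q : S) : green_R p q -> green_R q p by move=> h z; apply: iff_sym.
have Lt (p q t : S) : green_L p q -> green_L q t -> green_L p t.
  by move=> h1 h2 z; apply: iff_trans (h1 z) (h2 z).
have Rt (p q t : S) : green_R p q -> green_R q t -> green_R p t.
  by move=> h1 h2 z; apply: iff_trans (h1 z) (h2 z).
apply.
- by move=> p; exists p.
- move=> p q [z [pz zq]]; apply/green_LR_comm.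
  by exists z; split; [apply: Rs|apply: Ls].
- move=> p q t [z [pz zq]] [w [qw wt]].
  have /green_LR_comm[v [zv vw]] : exists v, green_R z v /\ green_L v w.
    by exists q.
  by exists v; split; [apply: Lt pz zv|apply: Rt vw wt].
- by move=> p q pq; exists q.
- by move=> p q pq; exists p.
Qed.

(* Relation between values of partial functions; it requires both values to be
   defined. *)
Definition rel_val (S : Type) (r : S -> S -> Prop) (o1 o2 : option S) : Prop :=
  match o1, o2 with
  | Some s, Some t => r s t
  | _, _ => False
  end.

(* Main.v *)
(** An element [(f, a)] of the partial wreath product is the same thing as a
    partial map [x |-> (f x, x a)] whose second component is injective.  In this
    picture, over a monoid [S], [v] lies in the left (resp. right) principal
    ideal of [u] as soon as it does so "fibrewise" over the points of the range
    (resp. domain), the multiplier being assembled from a multiplier chosen at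
    each point.  This gives L and R, hence H; for D, the element [z] with
    [u L z R v] is assembled in the same way from a bijection of the domains.
    Finally the iterated products are finite monoids, and D = J in any finite
    monoid: if [x = a x b] then [x = a^n x b^n] for all [n], and [a^i = a^j] for
    some [i < j] gives [x = a^(j-i) x], so [a] only moves [x] in its L-class. *)
Require Import Defs.
From HB Require Import structures.
From mathcomp Require Import all_boot all_fingroup.

Set Implicit Arguments.
Unset Strict Implicit.
Unset Printing Implicit Defensive.

Local Open Scope group_scope.

Definition has_unit (S : semigroupType) : Prop :=
  exists e : S, left_id e *%g /\ right_id e *%g.

(** Phrased as an injection because [wrp d k] is only a [semigroupType]; in this form finiteness
    passes through the recursion on [k]. *)
Definition embeds_in_finite (S : Type) : Prop :=
  exists (T : finType) (h : S -> T), injective h.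

(** * Green's relations in a monoid *)

(** Applying [g] and then [f] equally often to [x] gives back [x], so [x] lies in the image of the
    [i]-th iterate of [f], where the [n.+1]-st iterate is the identity. This form serves left and
    right multiplications alike. *)
Lemma iter_commuting_return (T : Type) (f g : T -> T) x i n :
  (forall y, f (g y) = g (f y)) -> f (g x) = x ->
  iter (n.+1 + i) f =1 iter i f -> iter n.+1 f x = x.
Proof.
move=> fgC fgx fi.
have fgm m : f (g (iter m g x)) = iter m g x.
  by elim: m => //= m IHm; rewrite fgC IHm.
have fgmm m : iter m f (iter m g x) = x.
  by elim: m => // m IHm; rewrite iterSr iterS fgm.
by rewrite -[in LHS](fgmm i) -iterD fi fgmm.
Qed.

Section Monoid.
Variable S : semigroupType.
Hypothesis S1 : has_unit S.
Implicit Types x y z : S.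

Lemma left_idealP x y : left_ideal x y <-> exists s, y = s * x.
Proof.
case: S1 => e [el _]; split=> [[[s|] ->]|[s ->]].
- by exists s.
- by exists e; rewrite el.
- by exists (Some s).
Qed.

Lemma right_idealP x y : right_ideal x y <-> exists t, y = x * t.
Proof.
case: S1 => e [_ er]; split=> [[[s|] ->]|[s ->]].
- by exists s.
- by exists e; rewrite er.
- by exists (Some s).
Qed.

Lemma two_sided_idealP x y : two_sided_ideal x y <-> exists s t, y = s * x * t.
Proof.
case: S1 => e [el er]; split=> [[s [t ->]]|[s [t ->]]].
  exists (if s is Some s then s else e), (if t is Some t then t else e).
  by case: s t => [s|] [t|] /=; rewrite ?el ?er.
by exists (Some s), (Some t).
Qed.

Lemma green_D_J x y : green_D x y -> green_J x y.
Proof.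
move=> [z [/green_LE[/left_idealP[s1 zx] /left_idealP[s2 xz]]
           /green_RE[/right_idealP[t1 yz] /right_idealP[t2 zy]]]] w.
split=> /two_sided_idealP[s [t ->]]; apply/two_sided_idealP.
- by exists (s * s2), (t2 * t); rewrite xz zy !mulgA.
- by exists (s * s1), (t1 * t); rewrite yz zx !mulgA.
Qed.

Hypothesis finS : embeds_in_finite S.

(** Pigeonhole on the first [#|T|.+1] iterates; writing the gap as [n.+1] keeps it positive. *)
Lemma ex_iter_eq (f : S -> S) x :
  exists i n, iter (n.+1 + i) f x = iter i f x.
Proof.
case: finS => T [h h_inj].
pose p (i : 'I_#|T|.+1) := h (iter i f x).
have /injectivePn[i [j neq_ij /h_inj eq_ij]] : ~~ injectiveb p.
  by apply/injectiveP => /leq_card; rewrite card_ord ltnn.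
wlog lt_ij : i j neq_ij eq_ij / i < j.
  move=> hw; case: (ltngtP i j) => [|/(hw j i)|/val_inj eij]; first exact: hw.
  - by apply; rewrite 1?eq_sym.
  - by rewrite eij eqxx in neq_ij.
by exists i, (j - i).-1; rewrite prednK ?subn_gt0 // subnK // ltnW.
Qed.

(** From y = sxt and x = pyq follows x = (ps)x(tq). Powers of ps and of tq repeat, which puts x in
    the left ideal of sx and in the right ideal of xt; hence x L sx R sxt = y. *)
Lemma green_J_D x y : green_J x y -> green_D x y.
Proof.
move=> xJy; have [e [el er]] := S1.
have /two_sided_idealP[s [t yE]] : two_sided_ideal x y by apply/xJy; exists None, None.
have /two_sided_idealP[p [q xE]] : two_sided_ideal y x by apply/xJy; exists None, None.
have xsxt : p * s * (x * (t * q)) = x by rewrite [in RHS]xE yE !mulgA.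
have comm z : p * s * (z * (t * q)) = p * s * z * (t * q) by rewrite mulgA.
(* Iterates at the unit [e] are the powers of ps, so one repetition there is a repetition at every
   point. Then (ps)^(n+1) x = x, and m = (ps)^n p. *)
have [m xL] : exists m, x = m * (s * x).
  have iterE n z : iter n (fun w => p * s * w) z = iter n (fun w => p * s * w) e * z.
    by elim: n => [|n /= ->]; rewrite ?el ?mulgA.
  have [i [n eq_in]] := ex_iter_eq (fun w => p * s * w) e.
  exists (iter n (fun w => p * s * w) e * p).
  rewrite -!mulgA (mulgA p) -iterE -(iterSr n (fun w => p * s * w)).
  rewrite (iter_commuting_return comm xsxt (i := i)) // => z.
  by rewrite iterE eq_in -iterE.
(* Mirror image: x (tq)^(n+1) = x, and r = q (tq)^n. *)
have [r xR] : exists r, x = x * t * r.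
  have iterE n z : iter n (fun w => w * (t * q)) z = z * iter n (fun w => w * (t * q)) e.
    by elim: n => [|n /= ->]; rewrite ?er ?mulgA.
  have [i [n eq_in]] := ex_iter_eq (fun w => w * (t * q)) e.
  exists (q * iter n (fun w => w * (t * q)) e).
  rewrite !mulgA -(mulgA x t) -iterE -(iterSr n (fun w => w * (t * q))).
  rewrite (iter_commuting_return (fun z => esym (comm z)) _ (i := i)) //.
    by rewrite -comm.
  by move=> z; rewrite iterE eq_in -iterE.
exists (s * x); split; [apply/green_LE|apply/green_RE]; split.
- by apply/left_idealP; exists s.
- by apply/left_idealP; exists m.
- by apply/right_idealP; exists t.
- by apply/right_idealP; exists r; rewrite yE -!mulgA (mulgA x) -xR.
Qed.

End Monoid.

(** * Elements of the wreath product as partial maps *)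

Section Wreath.
Variables (d : nat) (S : semigroupType).
Implicit Types (u v w : wreath d S) (x y z : 'I_d) (s t : S).

Definition wapp u x : option (S * 'I_d) :=
  obind (fun s => omap (pair s) ((wval u).2 x)) ((wval u).1 x).

Lemma wapp_Some u x s y :
  wapp u x = Some (s, y) <-> (wval u).1 x = Some s /\ (wval u).2 x = Some y.
Proof.
rewrite /wapp; case: ((wval u).1 x) ((wval u).2 x) => [s'|] [y'|] /=;
  split=> [|[]] //; first by case=> -> ->.
by case=> -> [->].
Qed.

Lemma isSome_wval u x : isSome ((wval u).1 x) = isSome ((wval u).2 x).
Proof. by case: u => [[f a] /= /eqP/setP/(_ x)]; rewrite !inE. Qed.

Lemma isSome_wapp u x : isSome (wapp u x) = isSome ((wval u).2 x).
Proof.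
by rewrite /wapp; have := isSome_wval u x; case: ((wval u).1 x) ((wval u).2 x) => [?|] [?|].
Qed.

Lemma wapp_inj u x x' s s' y :
  wapp u x = Some (s, y) -> wapp u x' = Some (s', y) -> x = x'.
Proof. by move=> /wapp_Some[_ ux] /wapp_Some[_]; apply: IS_inj. Qed.

(** Both components have the same domain, so joining them into one partial map loses nothing. *)
Lemma eq_wapp u v : wapp u =1 wapp v -> u = v.
Proof.
move=> uv; apply: val_inj; rewrite [LHS]surjective_pairing [RHS]surjective_pairing.
congr pair; last apply: val_inj; apply/ffunP => x; move: (uv x);
  rewrite /wapp; have := isSome_wval u x; have := isSome_wval v x; rewrite /=;
  case: ((wval u).1 x) => [s|]; case: ((wval u).2 x) => [y|];
  case: ((wval v).1 x) => [t|]; case: ((wval v).2 x) => [z|] //= _ _ [st yz];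
  by rewrite ?st ?yz.
Qed.

Lemma wapp_mul u v x :
  wapp (u * v) x =
  obind (fun p : S * 'I_d => omap (fun q => (p.1 * q.1, q.2)) (wapp v p.2)) (wapp u x).
Proof.
rewrite /wapp /= !ffunE; case: ((wval u).1 x) => //= s.
case: ((wval u).2 x) => //= y.
by case: ((wval v).1 y) => //= t; case: ((wval v).2 y).
Qed.

(** Source of every element assembled pointwise below: equality of domains is automatic, and only
    injectivity of the point component remains to be checked. *)
Lemma ex_wreath (F : 'I_d -> option (S * 'I_d)) :
  (forall x x' s s' y, F x = Some (s, y) -> F x' = Some (s', y) -> x = x') ->
  exists u, wapp u =1 F.
Proof.
move=> F_inj.
pose f : pfun d S := [ffun x => omap fst (F x)].
pose a : pfun d 'I_d := [ffun x => omap snd (F x)].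
have a_inj : dinjectiveb a (mem (pdom a)).
  apply: IS_intro => x x' y; rewrite !ffunE.
  case Fx: (F x) => [[s z]|] //=; case Fx': (F x') => [[s' z']|] //= [zy] [zy'].
  by apply: F_inj Fx _; rewrite Fx' zy zy'.
have dom_fa : pdom f == pdom (MkIS a_inj).
  by apply/eqP/setP => x; rewrite !inE !ffunE; case: (F x).
exists (Wreath (f, MkIS a_inj) dom_fa) => x; rewrite /wapp /= !ffunE.
by case: (F x) => [[]|].
Qed.

Lemma wreath_embeds_in_finite : embeds_in_finite S -> embeds_in_finite (wreath d S).
Proof.
case=> T [h h_inj]; exists ({ffun 'I_d -> option T} * IS d)%type.
exists (fun u => ([ffun x => omap h ((wval u).1 x)], (wval u).2)).
move=> [[f a] fa] [[g b] gb] /= [/ffunP fg ab].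
apply: val_inj; congr pair => //=; apply/ffunP => x; move: (fg x); rewrite !ffunE.
by case: (f x) (g x) => [s|] [t|] //= [/h_inj ->].
Qed.

Hypothesis S1 : has_unit S.

Lemma wreath_has_unit : has_unit (wreath d S).
Proof.
have [e [el er]] := S1.
have [|i iE] := @ex_wreath (fun x => Some (e, x)); first by move=> x x' s s' y [_ ->] [].
exists i; split=> u; apply: eq_wapp => x; rewrite wapp_mul.
  by rewrite iE /=; case: (wapp u x) => [[s y]|] //=; rewrite el.
by case: (wapp u x) => [[s y]|] //=; rewrite iE /= er.
Qed.

(** In v = wu, the multiplier [w] must send [x] to the point that [u] maps to the image of [x] under
    [v]; its label is a left multiplier in [S]. *)
Lemma wreath_left_idealP u v :
  left_ideal u v <->
  forall x t z, wapp v x = Some (t, z) ->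
    exists y s, wapp u y = Some (s, z) /\ left_ideal s t.
Proof.
split=> [/(left_idealP wreath_has_unit)[w ->] x t z|uv].
  rewrite wapp_mul; case: (wapp w x) => [[r y]|] //=.
  case uy: (wapp u y) => [[s z']|] //= [<- <-].
  by exists y, s; split=> //; apply/left_idealP => //; exists r.
(* [P x o] says that [o] is an admissible value of [w] at [x]. *)
pose P x (o : option (S * 'I_d)) := match o with
  | Some (r, y) => exists s z, wapp u y = Some (s, z) /\ wapp v x = Some (r * s, z)
  | None => wapp v x = None end.
have /fin_all_exists[F FP] x : exists o, P x o.
  case vx: (wapp v x) => [[t z]|]; last by exists None.
  have [y [s [uy /(left_idealP S1)[r tE]]]] := uv _ _ _ vx.
  by exists (Some (r, y)), s, z; rewrite -tE.
have [|w wE] := @ex_wreath F.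
  (* If [w] sends [x] and [x'] to the same [y], then [v] sends both to the image of [y] under
     [u]. *)
  move=> x x' r r' y Fx Fx'; move: (FP x) (FP x'); rewrite Fx Fx' /=.
  move=> [s [z [uy vx]]] [s' [z' [uy' vx']]].
  by move: uy'; rewrite uy => -[_ zz']; apply: wapp_inj vx _; rewrite vx' zz'.
apply/(left_idealP wreath_has_unit); exists w; apply: eq_wapp => x.
rewrite wapp_mul wE; move: (FP x); case: (F x) => [[r y]|] //=.
by move=> [s [z [-> ->]]].
Qed.

(** In v = uw, the multiplier acts after [u], so it is prescribed on the range of [u]; injectivity
    of [u] makes the prescription consistent. *)
Lemma wreath_right_idealP u v :
  right_ideal u v <->
  forall x t z, wapp v x = Some (t, z) ->
    exists s y, wapp u x = Some (s, y) /\ right_ideal s t.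
Proof.
split=> [/(right_idealP wreath_has_unit)[w ->] x t z|uv].
  rewrite wapp_mul; case: (wapp u x) => [[s y]|] //=.
  case wy: (wapp w y) => [[r z']|] //= [<- _].
  by exists s, y; split=> //; apply/right_idealP => //; exists r.
(* [None] covers the points outside the range of [u] and those whose preimage under [u] lies outside
   the domain of [v]. *)
pose P y (o : option (S * 'I_d)) := match o with
  | Some (r, z) => exists x s, wapp u x = Some (s, y) /\ wapp v x = Some (s * r, z)
  | None => forall x s, wapp u x = Some (s, y) -> wapp v x = None end.
have /fin_all_exists[F FP] y : exists o, P y o.
  case: (pickP (fun x => isSome (wapp v x) && (omap snd (wapp u x) == Some y))).
    move=> x /andP[]; case vx: (wapp v x) => [[t z]|] // _.
    have [s [y' [ux /(right_idealP S1)[r tE]]]] := uv _ _ _ vx.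
    by rewrite ux => /eqP[<-]; exists (Some (r, z)), x, s; rewrite -tE.
  move=> none; exists None => x s ux; move: (none x).
  by rewrite ux eqxx andbT; case: (wapp v x).
have [|w wE] := @ex_wreath F.
  (* Points with the same image under [w] have preimages under [u] with the same image under [v];
     these preimages coincide, hence so do the points. *)
  move=> y y' r r' z Fy Fy'; move: (FP y) (FP y'); rewrite Fy Fy' /=.
  move=> [x [s [ux vx]]] [x' [s' [ux' vx']]].
  by move: (ux'); rewrite -(wapp_inj vx vx') ux => -[].
apply/(right_idealP wreath_has_unit); exists w; apply: eq_wapp => x.
rewrite wapp_mul; case ux: (wapp u x) => [[s y]|] /=; last first.
  by case vx: (wapp v x) => [[t z]|] //; have [s [y []]] := uv _ _ _ vx; rewrite ux.
rewrite wE; move: (FP y); case: (F y) => [[r z]|] /=; last by move/(_ x s ux).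
move=> [x' [s' [ux' vx']]]; have xx' := wapp_inj ux ux'.
by move: ux' vx'; rewrite -xx' ux => -[<-].
Qed.

(** Passing from one element to the other and back over the same [z] returns to the starting point
    by injectivity, so both divisibilities concern the same pair of labels. *)
Lemma wreath_green_LP u v :
  green_L u v <->
  [/\ forall x t z, wapp v x = Some (t, z) ->
        exists y s, wapp u y = Some (s, z) /\ green_L s t
    & forall x s z, wapp u x = Some (s, z) ->
        exists y t, wapp v y = Some (t, z) /\ green_L s t].
Proof.
split=> [/green_LE[/wreath_left_idealP uv /wreath_left_idealP vu]|[uv vu]].
  split=> x r z rE.
    have [y [s [uy st]]] := uv _ _ _ rE; exists y, s; split=> //.
    have [x' [t' [vx' ts]]] := vu _ _ _ uy.
    move: (vx'); rewrite -(wapp_inj rE vx') rE => -[rt'].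
    by apply/green_LE; split; rewrite // rt'.
  have [y [t [vy ts]]] := vu _ _ _ rE; exists y, t; split=> //.
  have [x' [s' [ux' st]]] := uv _ _ _ vy.
  move: (ux'); rewrite -(wapp_inj rE ux') rE => -[rs'].
  by apply/green_LE; split; rewrite // rs'.
apply/green_LE; split; apply/wreath_left_idealP => x r z.
  by case/uv=> y [s [uy /green_LE[st _]]]; exists y, s.
by case/vu=> y [t [vy /green_LE[_ ts]]]; exists y, t.
Qed.

Lemma wreath_green_RP u v :
  green_R u v <-> forall x, match wapp u x, wapp v x with
    | Some (s, _), Some (t, _) => green_R s t
    | None, None => True
    | _, _ => False end.
Proof.
split=> [/green_RE[/wreath_right_idealP uv /wreath_right_idealP vu] x|uv].
  case ux: (wapp u x) => [[s y]|]; case vx: (wapp v x) => [[t z]|] //.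
  - have [s' [y' []]] := uv _ _ _ vx; have [t' [z' []]] := vu _ _ _ ux.
    rewrite vx ux => -[<- _] ts [<- _] st; exact/green_RE.
  - by have [t' [z' []]] := vu _ _ _ ux; rewrite vx.
  - by have [s' [y' []]] := uv _ _ _ vx; rewrite ux.
apply/green_RE; split; apply/wreath_right_idealP => x r z rE.
  move: (uv x); rewrite rE; case: (wapp u x) => [[s y]|] // /green_RE[].
  by exists s, y.
move: (uv x); rewrite rE; case: (wapp v x) => [[s y]|] // /green_RE[].
by exists s, y.
Qed.

End Wreath.

(** Choose a partner in each direction; uniqueness makes the two choice functions mutually
    inverse. *)
Lemma birelation_bijection (A B : finType) (Q : A -> B -> Prop) :
  (forall a, exists b, Q a b) -> (forall b, exists a, Q a b) ->
  (forall a b b', Q a b -> Q a b' -> b = b') ->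
  (forall a a' b, Q a b -> Q a' b -> a = a') ->
  exists f : A -> B, bijective f /\ forall a, Q a (f a).
Proof.
move=> /fin_all_exists[f fQ] /fin_all_exists[g gQ] Qf Qg.
exists f; split=> //; exists g => [a|b]; first exact: Qg (gQ _) (fQ _).
exact: Qf (fQ _) (gQ _).
Qed.

(** * Green's relations in terms of the components *)

Section Components.
Variables (d : nat) (S : semigroupType).
Hypothesis S1 : has_unit S.
Variables (f g : pfun d S) (a b : IS d).
Hypotheses (hf : pdom f == pdom a) (hg : pdom g == pdom b).
Let u : wreath d S := Wreath (f, a) hf.
Let v : wreath d S := Wreath (g, b) hg.

Lemma ppow_ISinv (h : pfun d S) (c : IS d) (hc : pdom h == pdom c) z s :
  ppow h (ISinv c) z = Some s <->
  exists y, wapp (Wreath (h, c) hc) y = Some (s, z).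
Proof.
rewrite ffunE; split=> [|[y /wapp_Some[/= hy /pconvP ->]]//].
case cz: (ISinv c z) => [y|] //= hy; exists y; apply/wapp_Some.
by move/pconvP: cz.
Qed.

Lemma mem_pran (h : pfun d S) (c : IS d) (hc : pdom h == pdom c) z :
  z \in pran c <-> exists y s, wapp (Wreath (h, c) hc) y = Some (s, z).
Proof.
rewrite inE; split=> [/existsP[y /eqP cy]|[y [s /wapp_Some[/= _ cy]]]].
  have := isSome_wapp (Wreath (h, c) hc) y; rewrite /= cy.
  case uy: (wapp _ y) => [[s z']|] // _; exists y, s; move: (uy).
  by case/wapp_Some => /= _; rewrite cy => -[->].
by apply/existsP; exists y; rewrite cy.
Qed.

Lemma mem_pdom (h : pfun d S) (c : IS d) (hc : pdom h == pdom c) z :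
  z \in pdom c <-> exists s y, wapp (Wreath (h, c) hc) z = Some (s, y).
Proof.
rewrite inE -[isSome (c z)](isSome_wapp (Wreath (h, c) hc) z).
by case: (wapp _ z) => [[s y]|]; split=> //; [exists s, y | case=> s []].
Qed.

(** The label attached to an image point [z] is the value at [z] of the first component composed
    with the inverse of the second. *)
Lemma wreath_green_L :
  green_L u v <->
  pran a = pran b /\
  forall z, z \in pran a ->
    rel_val (@green_L S) (ppow g (ISinv b) z) (ppow f (ISinv a) z).
Proof.
split=> [/(wreath_green_LP S1)[uv vu]|[ab fg]].
  split.
    apply/setP => z; apply/idP/idP.
      by case/(mem_pran hf) => y [s /vu[y' [t [vy' _]]]]; apply/(mem_pran hg); exists y', t.
    by case/(mem_pran hg) => y [s /uv[y' [t [vy' _]]]]; apply/(mem_pran hf); exists y', t.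
  move=> z /(mem_pran hf)[y [s uy]]; have [y' [t [vy' st]]] := vu _ _ _ uy.
  have -> : ppow f (ISinv a) z = Some s by apply/(ppow_ISinv hf); exists y.
  have -> : ppow g (ISinv b) z = Some t by apply/(ppow_ISinv hg); exists y'.
  by move=> r; apply: iff_sym.
apply/(wreath_green_LP S1); split=> x r z rE.
  have /fg : z \in pran a by rewrite ab; apply/(mem_pran hg); exists x, r.
  have -> : ppow g (ISinv b) z = Some r by apply/(ppow_ISinv hg); exists x.
  case fz: (ppow f _ z) => [s|] //= rs; move/(ppow_ISinv hf): fz => [y uy].
  by exists y, s; split=> // w; apply: iff_sym.
have /fg : z \in pran a by apply/(mem_pran hf); exists x, r.
have -> : ppow f (ISinv a) z = Some r by apply/(ppow_ISinv hf); exists x.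
case gz: (ppow g _ z) => [t|] //= tr; move/(ppow_ISinv hg): gz => [y vy].
by exists y, t; split=> // w; apply: iff_sym.
Qed.

Lemma wreath_green_R :
  green_R u v <->
  pdom a = pdom b /\ forall z, z \in pdom a -> rel_val (@green_R S) (f z) (g z).
Proof.
split=> [/(wreath_green_RP S1) uv|[ab fg]].
  split=> [|z]; first apply/setP => z.
    rewrite !inE -[isSome (a z)](isSome_wapp u) -[isSome (b z)](isSome_wapp v).
    by move: (uv z); case: (wapp u z) (wapp v z) => [[s y]|] [[t y']|].
  case/(mem_pdom hf) => s [y uz]; move: (uv z); rewrite uz.
  case vz: (wapp v z) => [[t y']|] //.
  by case/wapp_Some: uz => /= -> _; case/wapp_Some: vz => /= -> _.
apply/(wreath_green_RP S1) => x.
have : isSome (wapp u x) = isSome (wapp v x).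
  by rewrite !isSome_wapp /=; move/setP/(_ x): ab; rewrite !inE.
case ux: (wapp u x) => [[s y]|]; case vx: (wapp v x) => [[t z]|] // _.
have /fg : x \in pdom a by apply/(mem_pdom hf); exists s, y.
by case/wapp_Some: ux => /= -> _; case/wapp_Some: vx => /= -> _.
Qed.

(** An intermediate [w] with u L w R v has the domain of [v] and the range of [u]; matching points
    with equal images under [w] and [u] gives the bijection, and conversely a bijection dictates
    [w]. *)
Lemma wreath_green_D :
  green_D u v <->
  exists x : {z : 'I_d | z \in pdom b} -> {z : 'I_d | z \in pdom a},
    bijective x /\
    forall z, rel_val (@green_D S) (f (val (x z))) (g (val z)).
Proof.
split=> [[w [/(wreath_green_LP S1)[uw wu] /(wreath_green_RP S1) wv]]|].
  pose Q (z : {z : 'I_d | z \in pdom b}) (z' : {z : 'I_d | z \in pdom a}) :=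
    exists s r y, [/\ wapp u (val z') = Some (s, y), wapp w (val z) = Some (r, y)
                    & green_L s r].
  have [||||x [x_bij xQ]] := @birelation_bijection _ _ Q.
  - move=> z; have [t [y vz]] := (mem_pdom hg (val z)).1 (valP z).
    move: (wv (val z)); rewrite vz; case wz: (wapp w (val z)) => [[r y']|] // _.
    have [z' [s [uz' sr]]] := uw _ _ _ wz.
    have az' : z' \in pdom a by apply/(mem_pdom hf); exists s, y'.
    by exists (exist _ z' az'), s, r, y'.
  - move=> z'; have [s [y uz']] := (mem_pdom hf (val z')).1 (valP z').
    have [z [r [wz sr]]] := wu _ _ _ uz'.
    move: (wv z); rewrite wz; case vz: (wapp v z) => [[t y']|] // _.
    have bz : z \in pdom b by apply/(mem_pdom hg); exists t, y'.
    by exists (exist _ z bz), s, r, y.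
  - move=> z z' z'' [s [r [y [uz' wz _]]]] [s' [r' [y' [uz'' wz' _]]]].
    apply/val_inj; apply: wapp_inj uz' _; rewrite uz''.
    by move: wz'; rewrite wz => -[_ ->].
  - move=> z z' z'' [s [r [y [uz' wz _]]]] [s' [r' [y' [uz'' wz' _]]]].
    apply/val_inj; apply: wapp_inj wz _; rewrite wz'.
    by move: uz''; rewrite uz' => -[_ ->].
  exists x; split=> // z; have [s [r [y [/wapp_Some[/= -> _] wz sr]]]] := xQ z.
  move: (wv (val z)); rewrite wz; case vz: (wapp v (val z)) => [[t y']|] // rt.
  by case/wapp_Some: vz => /= -> _; exists r.
move=> [x [[x' xK x'K] xD]].
(* At [z] the element [w] takes an [r] with f(zx) L r R g(z) as label and the image of zx under [a]
   as point. *)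
pose P z (o : option (S * 'I_d)) := match o with
  | Some (r, y) => exists (bz : z \in pdom b) s t,
      [/\ wapp u (val (x (exist _ z bz))) = Some (s, y), g z = Some t,
          green_L s r & green_R r t]
  | None => z \notin pdom b end.
have /fin_all_exists[F FP] z : exists o, P z o.
  have [bz|] := boolP (z \in pdom b); last by exists None.
  have [s [y uz]] := (mem_pdom hf _).1 (valP (x (exist _ z bz))).
  move: (xD (exist _ z bz)); case/wapp_Some: (uz) => /= -> _.
  by case gz: (g z) => [t|] //= [r [sr rt]]; exists (Some (r, y)), bz, s, t.
have [|w wE] := @ex_wreath _ _ F.
  move=> z z' r r' y Fz Fz'; move: (FP z) (FP z'); rewrite Fz Fz' /=.
  move=> [bz [s [t [uz _ _ _]]]] [bz' [s' [t' [uz' _ _ _]]]].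
  by have /val_inj/(can_inj xK)[] := wapp_inj uz uz'.
exists w; split.
  apply/(wreath_green_LP S1); split=> z r y.
    rewrite wE => Fz; move: (FP z); rewrite Fz /= => -[bz [s [t [uz _ sr _]]]].
    by exists (val (x (exist _ z bz))), s.
  move=> uz; have az : z \in pdom a by apply/(mem_pdom hf); exists r, y.
  (* Each point of the range of [u] must be hit by [w]: the inverse bijection supplies the
     argument. *)
  set z0 := x' (exist _ z az); exists (val z0).
  move: (FP (val z0)); case Fz: (F (val z0)) => [[r' y']|] /=; last first.
    by rewrite (valP z0).
  move=> [bz [s [t [uz' _ sr _]]]]; exists r'; rewrite wE Fz; move: uz'.
  have -> : exist _ (val z0) bz = z0 by apply: val_inj.
  by rewrite /z0 x'K /= uz => -[-> ->].
apply/(wreath_green_RP S1) => z; rewrite wE; move: (FP z).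
case: (F z) => [[r y]|] /=.
  move=> [bz [s [t [_ gz _ rt]]]]; have [t' [y' vz]] := (mem_pdom hg _).1 bz.
  by rewrite vz; case/wapp_Some: vz => /=; rewrite gz => -[<-].
move=> bz; case vz: (wapp v z) => [[t y]|] //.
by case/negP: bz; apply/(mem_pdom hg); exists t, y.
Qed.

End Components.

(** * The iterated products are monoids embedding in finite types *)

Lemma IS_has_unit d : has_unit (IS d).
Proof.
have id_inj : dinjectiveb ([ffun x => Some x] : pfun d 'I_d)
    (mem (pdom ([ffun x => Some x] : pfun d 'I_d))).
  by apply: IS_intro => x y z; rewrite !ffunE => -[->] [].
exists (MkIS id_inj); split=> a; apply: val_inj; apply/ffunP => x /=; rewrite !ffunE //=.
by case: (a x) => //= y; rewrite ffunE.
Qed.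

(** The index [k.+1] skips the dummy level, so that [wrp d k.+2] unfolds to a wreath product over
    [wrp d k.+1]. *)
Lemma wrp_has_unit d k : has_unit (wrp d k.+1).
Proof. by elim: k => [|k IHk]; [apply: IS_has_unit | apply: wreath_has_unit]. Qed.

Lemma wrp_embeds_in_finite d k : embeds_in_finite (wrp d k.+1).
Proof.
by elim: k => [|k IHk]; [exists (IS d), id | apply: wreath_embeds_in_finite].
Qed.

(** The number of factors, at least 2, is rendered as [k.+2]. *)
Theorem mainTheorem5 (d : nat) (hd : 1 <= d) (k : nat) :
  (forall (f g : pfun d (wrp d k.+1)) (a b : IS d)
     (hf : pdom f == pdom a) (hg : pdom g == pdom b),
     let u : wrp d k.+2 := Wreath (f, a) hf in
     let v : wrp d k.+2 := Wreath (g, b) hg in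
     [/\ green_L u v <->
           pran a = pran b /\
           (forall z : 'I_d, z \in pran a ->
              rel_val (@green_L (wrp d k.+1))
                (ppow g (ISinv b) z) (ppow f (ISinv a) z)),
         green_R u v <->
           pdom a = pdom b /\
           (forall z : 'I_d, z \in pdom a ->
              rel_val (@green_R (wrp d k.+1)) (f z) (g z)),
         green_H u v <->
           [/\ pran a = pran b,
               pdom a = pdom b,
               (forall z : 'I_d, z \in pran a ->
                  rel_val (@green_L (wrp d k.+1))
                    (ppow g (ISinv b) z) (ppow f (ISinv a) z)) &
               (forall z : 'I_d, z \in pdom a ->
                  rel_val (@green_R (wrp d k.+1)) (f z) (g z))]
       & green_D u v <->
           (exists x : {z : 'I_d | z \in pdom b} -> {z : 'I_d | z \in pdom a},
              bijective x /\
              (forall z : {z : 'I_d | z \in pdom b},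
                 rel_val (@green_D (wrp d k.+1)) (f (val (x z))) (g (val z))))])
  /\
  (forall u v : wrp d k.+2, green_D u v <-> green_J u v).
Proof.
have S1 := wrp_has_unit d k; split=> [f g a b hf hg u v|u v]; last first.
  have w1 := wrp_has_unit d k.+1; split; first exact: green_D_J.
  exact: green_J_D w1 (wrp_embeds_in_finite d k.+1) u v.
have uLv := wreath_green_L S1 hf hg; have uRv := wreath_green_R S1 hf hg.
split=> //; last exact: wreath_green_D.
by split=> [[/uLv[? ?] /uRv[? ?]]|[? ? ? ?]]; split=> //; [apply/uLv|apply/uRv].
Qed.
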